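(* Let $n>t>k\ge 2$ be integers and suppose that $nk$ is even. If $H$ is a $k$-regular graph of order $t$, then there exists a $k$-regular graph $G$ of order $n$ such that $$\bigl|\,\|H\|_*-\|G\|_*\,\bigr| < 3\sqrt{(n-t)kn}.$$
   Context: Graphs are finite, simple and undirected; the order of a graph is its number of vertices. The energy $\|G\|_*$ of a graph $G$ is the sum of the absolute values of the eigenvalues of its adjacency matrix (counted with multiplicity). *)

(* Defs.v *)
From HB Require Import structures.
From mathcomp Require Import all_boot all_order all_algebra.
From mathcomp Require Import polyrcf.

Set Implicit Arguments.
Unset Strict Implicit.
Unset Printing Implicit Defensive.

Import Order.TTheory GRing.Theory Num.Theory.
Local Open Scope ring_scope.

(* Up to isomorphism, the vertices of a graph of order n are 0, ..., n-1. *)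
Record sgraph (n : nat) := SGraph {
  adj :> rel 'I_n;
  adj_sym : symmetric adj;
  adj_irrefl : irreflexive adj
}.

Definition regular (n k : nat) (G : sgraph n) : Prop :=
  forall x : 'I_n, #|[set y | G x y]| = k.

Definition adjmx (R : nzRingType) (n : nat) (G : sgraph n) : 'M[R]_n :=
  \matrix_(i, j) (G i j)%:R.

(* rootsR lists each real root of the characteristic polynomial once; the
   factor mup restores its multiplicity as an eigenvalue.  No eigenvalue
   is missed, as the adjacency matrix is real symmetric. *)
Definition energy (R : rcfType) (n : nat) (G : sgraph n) : R :=
  \sum_(x <- rootsR (char_poly (adjmx R G)))
     `|x| *+ mup x (char_poly (adjmx R G)).

Lemma mem_rootsR_eigenvalue (R : rcfType) (n : nat) (A : 'M[R]_n) (x : R) :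
  (x \in rootsR (char_poly A)) = eigenvalue A x.
Proof.
rewrite eigenvalue_root_char.
have p_neq0 : char_poly A != 0 by apply/monic_neq0/char_poly_monic.
by have := roots_on_rootsR p_neq0 x; rewrite in_itv /= => <-.
Qed.

(* Main.v *)
Require Import Defs.
From HB Require Import structures.
From mathcomp Require Import all_boot all_order all_algebra.
From mathcomp Require Import polyrcf complex zify.

(** Put s = n - t and add s isolated vertices to H.  This multiplies the
    characteristic polynomial by 'X^s and so leaves the energy unchanged
    ([energy_add_isolated]).  The padded graph is then turned into a k-regular
    graph G by changing few entries of its adjacency matrix, and this is enough
    because the energy is a Lipschitz function of that matrix.

    The Lipschitz bound ([trace_norm_dist], [energy_dist]).  The energy is the
    trace norm of the adjacency matrix, and the trace norm of a normal matrix A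
    is the maximum of |tr(A U)| over the unitary matrices U.  If A has a larger
    trace norm than B and U attains the maximum for A, then the two norms differ
    by at most |tr((A - B) U)|, which Cauchy-Schwarz bounds by the product of the Frobenius
    norms of A - B and of U, the latter being sqrt n.  For adjacency matrices the
    squared Frobenius norm of A - B counts the entries where they differ.  Hence
    the squared difference of the energies is at most n times this count.

    The completion ([complete_to_regular]).  The total deficiency, that is the
    sum of k - deg x over all vertices x, is s k for the padded graph.  It is
    even: t k is even by the handshake lemma, and n k is even by assumption.  As
    long as it is positive, two units of deficiency, at vertices u and v that may
    coincide, are removed either by adding the edge u v or by replacing some edge
    x y with the edges u x and v y ([raise_two_degrees]).  One step touches at
    most three edges, i.e. six entries, so that at most 3 s k entries change in
    all, and 3 s k n < 9 s k n = (3 sqrt (s k n))^2. *)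

Set Implicit Arguments.
Unset Strict Implicit.
Unset Printing Implicit Defensive.

Import Order.TTheory GRing.Theory Num.Theory.
Local Open Scope ring_scope.

(** * Completing a graph to a regular one *)

(** Every changed edge counts twice, once for each of its two entries in the
    adjacency matrix; this makes the distance a squared Frobenius norm. *)
Definition edit_dist n (G G' : sgraph n) : nat :=
  (\sum_i \sum_j (G i j != G' i j))%N.

Section Graphs.
Local Open Scope nat_scope.
Variable n : nat.
Implicit Types (G : sgraph n) (x y u v a b : 'I_n).

Definition degree G x : nat := \sum_y G x y.

Lemma card_nbhd G x : #|[set y | G x y]| = degree G x.
Proof.
rewrite -sum1_card big_mkcond; apply: eq_bigr => y _.
by rewrite inE; case: (G x y).
Qed.

(** The handshake lemma: by symmetry of the adjacency relation, the pairs x < y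
    and the pairs y < x contribute equally to the sum of the degrees. *)
Lemma even_sum_degree G : ~~ odd (\sum_x degree G x).
Proof.
pose up := \sum_(x : 'I_n) \sum_(y : 'I_n | (x < y)%N) G x y.
have down : up = \sum_(x : 'I_n) \sum_(y : 'I_n | (y < x)%N) G x y.
  rewrite /up (exchange_big_dep predT) //=; apply: eq_bigr => x _.
  by apply: eq_bigr => y _; rewrite adj_sym.
suff -> : \sum_x degree G x = up + up by rewrite addnn odd_double.
rewrite [in X in _ + X]down -big_split; apply: eq_bigr => x _ /=.
rewrite /degree (bigID (fun y : 'I_n => (x < y)%N)) /=; congr (_ + _).
rewrite (bigD1 x) ?ltnn //= adj_irrefl add0n.
by apply: eq_bigl => y; rewrite -leqNgt -val_eqE /= ltn_neqAle andbC.
Qed.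

Lemma edit_dist_refl G : edit_dist G G = 0.
Proof. by apply: big1 => i _; apply: big1 => j _; rewrite eqxx. Qed.

Lemma edit_dist_trans G2 G1 G3 :
  edit_dist G1 G3 <= edit_dist G1 G2 + edit_dist G2 G3.
Proof.
rewrite -big_split; apply: leq_sum => i _; rewrite -big_split.
by apply: leq_sum => j _ /=; case: (G1 i j); case: (G2 i j); case: (G3 i j).
Qed.

Definition edge x y : rel 'I_n :=
  fun a b => (a == x) && (b == y) || (a == y) && (b == x).

Lemma edge_sym x y : symmetric (edge x y).
Proof. by move=> a b; rewrite /edge orbC andbC [X in _ || X]andbC. Qed.

Lemma edge_irrefl x y : x != y -> irreflexive (edge x y).
Proof.
move=> xy a; rewrite /edge [X in _ || X]andbC orbb.
by case: eqVneq => // ->; apply: negbTE.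
Qed.

Lemma sum_edge x y a : x != y -> \sum_b edge x y a b = (a == x) + (a == y).
Proof.
move=> xy; have sum_pt z : \sum_b (b == z) = 1.
  by rewrite -big_mkcond /= big_pred1_eq.
under eq_bigr => b _.
  have -> : edge x y a b = (a == x) * (b == y) + (a == y) * (b == x) :> nat.
    rewrite /edge; case: (eqVneq a x) xy => [->|_] xy.
      by rewrite (negbTE xy) /= orbF mul1n mul0n addn0.
    by rewrite mul0n add0n mulnb.
over.
by rewrite big_split -!big_distrr /= !sum_pt !muln1.
Qed.

(** All modifications of a graph are made of toggles of single edges, so that
    the effect on the distance is the same whether an edge appears or goes. *)
Section Toggle.
Variables (G : sgraph n) (x y : 'I_n) (xy : x != y).

Definition toggle_rel : rel 'I_n := fun a b => G a b (+) edge x y a b.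

Lemma toggle_sym : symmetric toggle_rel.
Proof. by move=> a b; rewrite /toggle_rel adj_sym edge_sym. Qed.

Lemma toggle_irrefl : irreflexive toggle_rel.
Proof. by move=> a; rewrite /toggle_rel adj_irrefl edge_irrefl. Qed.

Definition toggle := SGraph toggle_sym toggle_irrefl.

Lemma edit_dist_toggle : edit_dist G toggle = 2.
Proof.
have -> : edit_dist G toggle = \sum_a \sum_b edge x y a b.
  apply: eq_bigr => a _; apply: eq_bigr => b _ /=.
  by rewrite /toggle_rel; case: (G a b); case: edge.
under eq_bigr => a _ do rewrite sum_edge //.
by rewrite big_split /= -!big_mkcond /= !big_pred1_eq.
Qed.

Lemma degree_toggle_add a :
  ~~ G x y -> degree toggle a = degree G a + (a == x) + (a == y).
Proof.
move=> nGxy; rewrite -addnA -sum_edge // -big_split; apply: eq_bigr => b _ /=.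
rewrite /toggle_rel; have [/orP e|] := boolP (edge x y a b); last first.
  by rewrite addbF addn0.
suff /negbTE-> : ~~ G a b by [].
by case: e => /andP[/eqP-> /eqP->] //; rewrite adj_sym.
Qed.

Lemma degree_toggle_del a :
  G x y -> degree toggle a + (a == x) + (a == y) = degree G a.
Proof.
move=> Gxy; rewrite -addnA -sum_edge // -big_split; apply: eq_bigr => b _ /=.
rewrite /toggle_rel; have [/orP e|] := boolP (edge x y a b); last first.
  by rewrite addbF addn0.
suff -> : G a b by [].
by case: e => /andP[/eqP-> /eqP->] //; rewrite adj_sym.
Qed.

End Toggle.

(** Exchanging the edge x y for u x and v y restores the degrees of x and y and
    raises those of u and v by one each, or by two if u = v.  That u is equal or
    adjacent to v, while x is neither equal nor adjacent to u, and y neither to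
    v, keeps {x, y} disjoint from {u, v}; so the three toggles do not
    interfere. *)
Lemma edge_switch G u v x y :
  (u == v) || G u v -> x != u -> ~~ G u x -> y != v -> ~~ G v y -> G x y ->
  exists2 G', (forall a, degree G' a = degree G a + (a == u) + (a == v))
            & edit_dist G G' <= 6.
Proof.
move=> uv xu nGux yv nGvy Gxy.
have xy : x != y by apply: contraTneq Gxy => ->; rewrite adj_irrefl.
have xv : x != v.
  by apply: contraNneq nGux => xv; move: uv; rewrite -xv eq_sym (negbTE xu).
have yu : y != u.
  by apply: contraNneq nGvy => yu; move: uv; rewrite adj_sym -yu (negbTE yv).
have ux : u != x by rewrite eq_sym.
have vy : v != y by rewrite eq_sym.
pose G1 := toggle G xy; pose G2 := toggle G1 ux; pose G3 := toggle G2 vy.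
exists G3.
  have nG1ux : ~~ G1 u x.
    rewrite /= /toggle_rel (negbTE nGux) /edge (negbTE ux).
    by rewrite [u == y]eq_sym (negbTE yu).
  have nG2vy : ~~ G2 v y.
    rewrite /= /toggle_rel /= /toggle_rel (negbTE nGvy) /edge.
    rewrite [v == x]eq_sym (negbTE xv) (negbTE vy).
    by rewrite [y == x]eq_sym (negbTE xy) (negbTE yu) !andbF.
  move=> a; rewrite degree_toggle_add // degree_toggle_add //.
  rewrite -(degree_toggle_del xy a Gxy) -/G1; move: (degree G1 a) => d.
  by clear -a u v x y d; lia.
apply: leq_trans (edit_dist_trans G2 _ _) _; rewrite edit_dist_toggle.
have := edit_dist_trans G1 G G2; rewrite !edit_dist_toggle; lia.
Qed.

Section Completion.
Variable k : nat.

Definition full G := [set x | degree G x == k].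

(** If u and v are distinct and not adjacent, the edge u v is added.  Otherwise
    an edge x y to switch is found by counting.  There are more than k vertices
    of degree k, but at most k in the closed neighbourhood N[u], so some x of
    degree k is outside N[u].  The neighbours of x cannot all be in N[v]: as
    u is in N[v] but not adjacent to x, they would lie in N[v] without u, which
    has deg v < k elements. *)
Lemma raise_two_degrees G u v :
  degree G u < k -> degree G v < k -> k < #|full G| ->
  exists2 G', (forall a, degree G' a = degree G a + (a == u) + (a == v))
            & edit_dist G G' <= 6.
Proof.
move=> du dv k_lt_full.
have [uv | ] := boolP ((u == v) || G u v); last first.
  rewrite negb_or => /andP[uv nGuv]; exists (toggle G uv).
    by move=> a; rewrite degree_toggle_add.
  by rewrite edit_dist_toggle.
have [x] : exists2 x, x \in full G & x \notin u |: [set y | G u y].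
  apply/subsetPn; apply: contraL k_lt_full => /subset_leq_card.
  by rewrite -leqNgt cardsU1 inE adj_irrefl card_nbhd; lia.
rewrite !inE negb_or => /eqP dx /andP[xu nGux].
have [y] : exists2 y, y \in [set y | G x y] &
    y \notin (v |: [set y | G v y]) :\ u.
  apply/subsetPn; apply: contraL dv => /subset_leq_card.
  have := cardsD1 u (v |: [set y | G v y]).
  rewrite cardsU1 !inE adj_irrefl !card_nbhd dx [G v u]adj_sym uv; lia.
have [-> | yu] := eqVneq y u; first by rewrite inE adj_sym (negbTE nGux).
rewrite !inE yu negb_or => Gxy /andP[yv nGvy].
exact: edge_switch uv xu nGux yv nGvy Gxy.
Qed.

(** Either one vertex lacks two edges and serves as both u and v, or every
    deficient vertex lacks exactly one, and then there are at least two. *)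
Lemma deficient_pair G : (forall x, degree G x <= k) ->
  1 < \sum_x (k - degree G x) ->
  exists u v, [/\ degree G u < k, degree G v < k &
    forall a, degree G a + (a == u) + (a == v) <= k].
Proof.
move=> le_k sum_gt1.
have ex_pos (P : pred 'I_n) : 0 < \sum_(x | P x) (k - degree G x) ->
    exists2 x, P x & degree G x < k.
  rewrite lt0n sum_nat_eq0 negb_forall => /existsP[x].
  by rewrite negb_imply subn_eq0 -ltnNge => /andP[Px dx]; exists x.
have [|v _ dv] := ex_pos predT; first exact: ltnW.
have [dv2 | dv1] := leqP (degree G v + 2) k.
  exists v, v; split=> // a; have := le_k a.
  by case: eqVneq => [-> | _]; lia.
move: sum_gt1; rewrite (bigD1 v) //= => sum_gt1.
have [|u uv du] := ex_pos (predC1 v).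
  rewrite -(ltn_add2l (k - degree G v)) addn0.
  by apply: leq_ltn_trans sum_gt1; lia.
exists u, v; split=> // a; have := le_k a; have {}uv : u != v := uv.
case: (eqVneq a u) => [-> | _]; first by rewrite (negbTE uv); lia.
by case: (eqVneq a v) => [-> | _]; lia.
Qed.

(** Vertices that have reached degree k keep it, so the number of vertices of
    degree k needed at every step stays available. *)
Lemma complete_to_regular d G : (forall x, degree G x <= k) ->
  k < #|full G| -> \sum_x (k - degree G x) = d.*2 ->
  exists2 G', regular k G' & edit_dist G G' <= 6 * d.
Proof.
elim: d G => [|d IHd] G le_k k_lt_full sum_def.
  exists G; last by rewrite edit_dist_refl.
  move=> x; rewrite card_nbhd; apply/eqP; rewrite eqn_leq le_k /= -subn_eq0.
  by move/eqP: sum_def; rewrite sum_nat_eq0 => /forallP/(_ x).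
have [|u [v [du dv le_k']]] := deficient_pair le_k; first by rewrite sum_def; lia.
have [G1 degG1 distG1] := raise_two_degrees du dv k_lt_full.
have [|||G' regG' distG'] := IHd G1.
- by move=> x; rewrite degG1.
- apply: leq_trans k_lt_full (subset_leq_card _); apply/subsetP => x.
  rewrite !inE degG1 => /eqP dx; rewrite dx; have := le_k' x; rewrite dx; lia.
- have : \sum_x (k - degree G1 x) + \sum_x ((x == u) + (x == v)) = d.+1.*2.
    rewrite -sum_def -big_split; apply: eq_bigr => x _ /=.
    rewrite degG1 -addnA subnDA subnK // -(leq_add2l (degree G x)) subnKC //.
    by rewrite addnA.
  by rewrite [X in _ + X]big_split /= -!big_mkcond /= !big_pred1_eq; lia.
exists G' => //; apply: leq_trans (edit_dist_trans G1 _ _) _; lia.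
Qed.

End Completion.
End Graphs.

(** * Adding isolated vertices *)

Section AddIsolated.
Variables t s : nat.
Variable H : sgraph t.

Definition add_isolated_rel : rel 'I_(t + s) := fun x y =>
  match split x, split y with inl a, inl b => H a b | _, _ => false end.

Lemma add_isolated_sym : symmetric add_isolated_rel.
Proof.
move=> x y; rewrite /add_isolated_rel.
by case: (split x) => a; case: (split y) => b //; rewrite adj_sym.
Qed.

Lemma add_isolated_irrefl : irreflexive add_isolated_rel.
Proof.
by move=> x; rewrite /add_isolated_rel; case: (split x) => // a; exact: adj_irrefl.
Qed.

Definition add_isolated := SGraph add_isolated_sym add_isolated_irrefl.

Lemma adjmx_add_isolated (K : nzRingType) :
  adjmx K add_isolated = block_mx (adjmx K H) 0 0 0.
Proof.
apply/matrixP => x y; rewrite -[x]splitK -[y]splitK mxE /=.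
rewrite /add_isolated_rel !unsplitK.
case: (split x) => a; case: (split y) => b /=.
- by rewrite block_mxEul mxE.
- by rewrite block_mxEur mxE.
- by rewrite block_mxEdl mxE.
- by rewrite block_mxEdr mxE.
Qed.

Lemma add_isolated_unsplit (u v : 'I_t + 'I_s) :
  add_isolated (unsplit u) (unsplit v) =
  if (u, v) is (inl a, inl b) then H a b else false.
Proof. by rewrite /= /add_isolated_rel !unsplitK; case: u; case: v. Qed.

Lemma degree_add_isolated_old a : degree add_isolated (lshift s a) = degree H a.
Proof.
rewrite /degree big_split_ord -[RHS]addn0; congr addn.
  by apply: eq_bigr => b _; rewrite (add_isolated_unsplit (inl a) (inl b)).
by apply: big1 => b _; rewrite (add_isolated_unsplit (inl a) (inr b)).
Qed.

Lemma degree_add_isolated_new b : degree add_isolated (rshift t b) = 0%N.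
Proof.
apply: big1 => y _; rewrite -[y]splitK.
by rewrite (add_isolated_unsplit (inr b) (split y)).
Qed.

End AddIsolated.

(** * The trace norm of normal matrices *)

Section TraceNorm.
Variable C : numClosedFieldType.
Local Open Scope sesquilinear_scope.

(** Normal matrices are the ones that [spectral_diag] diagonalizes; for them the
    sum of the moduli of the eigenvalues is the sum of the singular values. *)
Definition trace_norm n (A : 'M[C]_n) : C := \sum_i `|spectral_diag A 0 i|.

Lemma mxtrace_mul_trmxC m n (A B : 'M[C]_(m, n)) :
  \tr (A *m B ^t*) = \sum_i \sum_j A i j * (B i j)^*.
Proof.
by apply: eq_bigr => i _; rewrite mxE; apply: eq_bigr => j _; rewrite !mxE.
Qed.

Lemma dotmx_mxvec m n (A B : 'M[C]_(m, n)) :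
  dotmx (mxvec A) (mxvec B) = \tr (A *m B ^t*).
Proof.
rewrite dotmxE mxE mxtrace_mul_trmxC (reindex _ (curry_mxvec_bij m n)) /=.
rewrite pair_bigA /=; apply: eq_bigr => -[i j] _ /=.
by rewrite !mxE !mxvecE.
Qed.

(** Cauchy-Schwarz for the Frobenius inner product: n is the squared Frobenius
    norm of a unitary matrix. *)
Lemma mxtrace_unitary_le n (A U : 'M[C]_n) : U \is unitarymx ->
  `|\tr (A *m U)| ^+ 2 <= n%:R * \sum_i \sum_j `|A i j| ^+ 2.
Proof.
move=> Uu; rewrite -(trmxCK U) -dotmx_mxvec.
have le_CS m (u v : 'rV[C]_m) : `|dotmx u v| ^+ 2 <= dotmx u u * dotmx v v.
  by have [] := CauchySchwarz (@dotmx C m) u v.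
apply: (le_trans (le_CS _ _ _)); rewrite !dotmx_mxvec trmxCK.
have -> : U ^t* *m U = 1%:M by apply/mulmx1C/unitarymxP.
rewrite mxtrace1 mulrC ler_wpM2l ?ler0n // mxtrace_mul_trmxC.
by apply: ler_sum => i _; apply: ler_sum => j _; rewrite normCK.
Qed.

Lemma unitary_entry_le1 n (U : 'M[C]_n) i j : U \is unitarymx -> `|U i j| <= 1.
Proof.
move=> /unitarymxP /matrixP/(_ i i); rewrite !mxE eqxx mulr1n => row1.
rewrite -(@ler_pXn2r _ 2) ?nnegrE ?ler01 //.
rewrite expr1n -row1 (bigD1 j) //= !mxE normCK lerDl.
by apply: sumr_ge0 => l _; rewrite !mxE -normCK exprn_ge0.
Qed.

Lemma spectral_mxtrace n (A U : 'M[C]_n) (P := spectralmx A) : A \is normalmx ->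
  \tr (A *m U) = \sum_i spectral_diag A 0 i * (P *m U *m invmx P) i i.
Proof.
move=> /orthomx_spectralP {1}->.
rewrite -!mulmxA mxtrace_mulC -!mulmxA.
by apply: eq_bigr => i _; rewrite mul_diag_mx mxE.
Qed.

(** In an orthonormal basis of eigenvectors of A, the trace of A U is the sum of
    the eigenvalues weighted by diagonal entries of a unitary matrix, and these
    have modulus at most 1. *)
Lemma mxtrace_le_trace_norm n (A U : 'M[C]_n) : A \is normalmx ->
  U \is unitarymx -> `|\tr (A *m U)| <= trace_norm A.
Proof.
move=> An Uu; rewrite spectral_mxtrace //.
apply: le_trans (ler_norm_sum _ _ _) _.
apply: ler_sum => i _; rewrite normrM ler_piMr ?normr_ge0 //.
have Pu := spectral_unitarymx A.
by rewrite unitary_entry_le1 // invmx_unitary // !mul_unitarymx ?trmxC_unitary.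
Qed.

(** The maximizer acts on the eigenvectors of A as the conjugate of the phase of
    the eigenvalue, as in a polar decomposition. *)
Lemma trace_norm_attained n (A : 'M[C]_n) : A \is normalmx ->
  exists2 U, U \is unitarymx & \tr (A *m U) = trace_norm A.
Proof.
move=> An; set P := spectralmx A; set d := spectral_diag A.
have Pu : P \is unitarymx := spectral_unitarymx A.
(* The phase of a zero eigenvalue is arbitrary, but must have modulus 1. *)
pose e := \row_i (if d 0 i == 0 then 1 else `|d 0 i| / d 0 i) : 'rV[C]_n.
exists (invmx P *m diag_mx e *m P).
  rewrite invmx_unitary // !mul_unitarymx ?trmxC_unitary //.
  apply/unitarymxP; rewrite tr_diag_mx map_diag_mx mulmx_diag.
  rewrite -[RHS]diag_const_mx; congr diag_mx; apply/rowP => i; rewrite !mxE.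
  rewrite -normCK; case: eqP => [_|/eqP d0]; first by rewrite normr1 expr1n.
  by rewrite normf_div normr_id divff ?expr1n ?normr_eq0.
rewrite spectral_mxtrace // -/P -/d; apply: eq_bigr => i _.
rewrite !mulmxA mulmxV ?spectral_unit // mul1mx mulmxK ?spectral_unit //.
rewrite !mxE eqxx mulr1n -/d; case: eqP => [->|/eqP d0].
  by rewrite normr0 mul0r.
by rewrite mulrC divfK.
Qed.

Lemma trace_norm_ge0 n (A : 'M[C]_n) : 0 <= trace_norm A.
Proof. by apply: sumr_ge0. Qed.

(** Being a maximum of the functions |tr(A U)|, each of which is Lipschitz in A
    with constant sqrt n for the Frobenius norm, the trace norm is Lipschitz with
    the same constant. *)
Lemma trace_norm_dist n (A B : 'M[C]_n) : A \is normalmx -> B \is normalmx ->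
  `|trace_norm A - trace_norm B| ^+ 2
    <= n%:R * \sum_i \sum_j `|A i j - B i j| ^+ 2.
Proof.
move=> An Bn.
have dist_le (A' B' : 'M[C]_n) : A' \is normalmx -> B' \is normalmx ->
    trace_norm B' <= trace_norm A' ->
    `|trace_norm A' - trace_norm B'| ^+ 2
      <= n%:R * \sum_i \sum_j `|A' i j - B' i j| ^+ 2.
  move=> A'n B'n leBA; have [U Uu trU] := trace_norm_attained A'n.
  have := mxtrace_unitary_le (A' - B') Uu.
  under eq_bigr do under eq_bigr do rewrite !mxE.
  apply: le_trans; rewrite ler_pXn2r ?nnegrE ?normr_ge0 //.
  rewrite ger0_norm ?subr_ge0 // lerBlDr.
  rewrite -[leLHS]ger0_norm ?trace_norm_ge0 // -trU -[in leLHS](subrK B' A').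
  rewrite mulmxDl mxtraceD; apply: le_trans (ler_normD _ _) _.
  by rewrite lerD2l mxtrace_le_trace_norm.
have [le_AB | le_BA] := orP (ger_leVge (trace_norm_ge0 A) (trace_norm_ge0 B)).
  rewrite distrC; under eq_bigr do under eq_bigr do rewrite distrC.
  exact: dist_le.
exact: dist_le.
Qed.

Lemma char_poly_normal n (A : 'M[C]_n) : A \is normalmx ->
  char_poly A = \prod_i ('X - (spectral_diag A 0 i)%:P).
Proof.
move=> /orthomx_spectralP A_eq; rewrite {1}A_eq.
set P := spectralmx A; set D := diag_mx _.
have Pu : P \in unitmx := spectral_unit A.
pose Q := map_mx polyC P.
have QV : map_mx polyC (invmx P) *m Q = 1%:M.
  by rewrite -map_mxM mulVmx // map_mx1.
rewrite /char_poly /char_poly_mx !map_mxM -/Q /=.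
have -> : 'X%:M = map_mx polyC (invmx P) *m 'X%:M *m Q.
  by rewrite scalar_mxC -mulmxA QV mulmx1.
rewrite -mulmxBl -mulmxBr !det_mulmx mulrAC -det_mulmx QV det1 mul1r.
rewrite -[LHS]/(char_poly D) char_poly_trig ?diag_mx_is_trig //.
by apply: eq_bigr => i _; rewrite !mxE eqxx mulr1n.
Qed.

End TraceNorm.

(** * Graph energy as a trace norm *)

Section Energy.
Variable R : rcfType.

Lemma mup_prod_XsubC (F : fieldType) (rs : seq F) x :
  mup x (\prod_(z <- rs) ('X - z%:P)) = count_mem x rs.
Proof.
elim: rs => [|z rs IH]; first by rewrite big_nil mupNroot // root1.
rewrite big_cons mupM ?polyXsubC_eq0 ?monic_neq0 ?monic_prod_XsubC //.
by rewrite IH /= -['X - z%:P]expr1 mup_XsubCX; case: eqP.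
Qed.

(** Listing each real root once with its multiplicity is the same as listing the
    factors of a split polynomial; this makes the energy computable from any
    factorization of the characteristic polynomial. *)
Lemma sum_rootsR_prod_XsubC (V : nmodType) (f : R -> V) (rs : seq R)
    (p := \prod_(z <- rs) ('X - z%:P)) :
  \sum_(x <- rootsR p) f x *+ mup x p = \sum_(z <- rs) f z.
Proof.
have p_neq0 : p != 0 by apply/monic_neq0/monic_prod_XsubC.
have mem_p x : (x \in rootsR p) = (x \in rs).
  have := roots_on_rootsR p_neq0 x.
  by rewrite in_itv /= root_prod_XsubC.
have perm_roots : perm_eq (rootsR p) (undup rs).
  apply: uniq_perm (lt_sorted_uniq (sorted_roots _ _ _)) (undup_uniq _) _ => x.
  by rewrite mem_p mem_undup.
rewrite (perm_big _ perm_roots) -[RHS]big_undup_iterop_count /=.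
by apply: eq_bigr => x _; rewrite mup_prod_XsubC.
Qed.

Lemma energy_prod_XsubC n (G : sgraph n) (rs : seq R) :
  char_poly (adjmx R G) = \prod_(z <- rs) ('X - z%:P) ->
  energy R G = \sum_(z <- rs) `|z|.
Proof. by move=> cpG; rewrite /energy cpG sum_rootsR_prod_XsubC. Qed.

Local Notation toC := (real_complex R).

Lemma adjmx_hermsym n (G : sgraph n) : adjmx R[i] G \is hermsymmx.
Proof.
apply: realsym_hermsym.
  apply/is_hermitianmxP; rewrite expr0 scale1r map_mx_id //.
  by apply/matrixP => i j; rewrite !mxE adj_sym.
by apply/mxOverP => i j; rewrite mxE realn.
Qed.

Lemma adjmx_normal n (G : sgraph n) : adjmx R[i] G \is normalmx.
Proof. exact/hermitian_normalmx/adjmx_hermsym. Qed.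

(** The adjacency matrix is diagonalized over the complex numbers R[i]; since it
    is Hermitian there, its eigenvalues are real and the factorization of the
    characteristic polynomial descends to R. *)
Lemma char_poly_adjmx_split n (G : sgraph n) (A := adjmx R[i] G)
    (rs := [seq complex.Re (spectral_diag A 0 i) | i : 'I_n]) :
  char_poly (adjmx R G) = \prod_(z <- rs) ('X - z%:P).
Proof.
apply: (map_poly_inj toC); rewrite map_char_poly rmorph_prod /=.
have -> : map_mx toC (adjmx R G) = A.
  by apply/matrixP => i j; rewrite !mxE /= rmorph_nat.
rewrite char_poly_normal ?adjmx_normal // big_map big_enum /=.
apply: eq_bigr => i _; rewrite rmorphB /= map_polyX map_polyC /= RRe_real //.
exact/mxOverP/hermitian_spectral_diag_real/adjmx_hermsym.
Qed.

Lemma energy_trace_norm n (G : sgraph n) :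
  toC (energy R G) = trace_norm (adjmx R[i] G).
Proof.
rewrite (energy_prod_XsubC (char_poly_adjmx_split G)) big_map big_enum /=.
rewrite rmorph_sum; apply: eq_bigr => i _ /=.
have /mxOverP/(_ 0 i)/RRe_real {2}<- :=
  hermitian_spectral_diag_real (adjmx_hermsym G).
by rewrite normc_def /= expr0n addr0 sqrtr_sqr.
Qed.

(** Two adjacency entries differ by 0 or by a number of modulus 1, so the squared
    Frobenius norm of the difference is the edit distance. *)
Lemma energy_dist n (G G' : sgraph n) :
  `|energy R G - energy R G'| ^+ 2 <= (n * edit_dist G G')%:R.
Proof.
have := trace_norm_dist (adjmx_normal G) (adjmx_normal G').
rewrite -!energy_trace_norm -rmorphB /= normc_def /= expr0n addr0 sqrtr_sqr.
rewrite -rmorphXn /=.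
suff -> : n%:R * \sum_i \sum_j `|adjmx R[i] G i j - adjmx _ G' i j| ^+ 2
  = toC (n * edit_dist G G')%:R by rewrite lecR.
rewrite natrM rmorphM !rmorph_nat natr_sum; congr (_ * _).
apply: eq_bigr => i _; rewrite natr_sum; apply: eq_bigr => j _.
by rewrite !mxE; case: (G i j); case: (G' i j);
  rewrite ?subrr ?subr0 ?sub0r ?normrN ?normr1 ?normr0 ?expr1n ?expr0n.
Qed.

Lemma energy_add_isolated t s (H : sgraph t) :
  energy R (add_isolated s H) = energy R H.
Proof.
have [rs cpH] : exists rs : seq R,
    char_poly (adjmx R H) = \prod_(z <- rs) ('X - z%:P).
  by eexists; apply: char_poly_adjmx_split.
rewrite (energy_prod_XsubC cpH) (@energy_prod_XsubC _ _ (rs ++ nseq s 0)).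
  rewrite big_cat /= [X in _ + X]big1_seq ?addr0 // => x /andP[_ /nseqP[-> _]].
  exact: normr0.
rewrite adjmx_add_isolated /char_poly char_block_diag_mx det_ublock.
rewrite big_cat /= -cpH.
congr (_ * _); rewrite /char_poly_mx map_mx0 subr0 det_scalar.
by rewrite big_nseq -Monoid.iteropE subr0.
Qed.

End Energy.

(** * Energies of regular graphs of different orders *)

Theorem theorem9 (R : rcfType) (n t k : nat)
    (le_2k : (2 <= k)%N) (lt_kt : (k < t)%N) (lt_tn : (t < n)%N)
    (nk_even : ~~ odd (n * k)%N)
    (H : sgraph t) (H_reg : regular k H) :
  exists G : sgraph n,
    regular k G /\
    `|energy R H - energy R G| < 3 * Num.sqrt ((n - t) * k * n)%N%:R.
Proof.
have [s def_n] : exists s, n = (t + s)%N.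
  by exists (n - t)%N; rewrite subnKC // ltnW.
subst n; rewrite addKn.
have degH x : degree H x = k by rewrite -card_nbhd H_reg.
have sk_even : ~~ odd (s * k).
  have := even_sum_degree H.
  rewrite (eq_bigr (fun=> k)) => [|x _ //].
  rewrite sum_nat_const card_ord => tk_even.
  by move: nk_even; rewrite mulnDl oddD (negbTE tk_even).
have deg_le x : (degree (add_isolated s H) x <= k)%N.
  rewrite -[x]splitK; case: (split x) => a /=.
    by rewrite degree_add_isolated_old degH.
  by rewrite degree_add_isolated_new.
have k_lt_full : (k < #|full k (add_isolated s H)|)%N.
  apply: (leq_trans lt_kt); rewrite -[t in (t <= _)%N]card_ord.
  rewrite -(card_imset _ (@lshift_inj t s)); apply: subset_leq_card.
  apply/subsetP => _ /imsetP[a _ ->].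
  by rewrite inE degree_add_isolated_old degH.
have sum_def : (\sum_x (k - degree (add_isolated s H) x) = (s * k)./2.*2)%N.
  rewrite even_halfK // big_split_ord /= big1 ?add0n => [|a _]; last first.
    by rewrite degree_add_isolated_old degH subnn.
  under eq_bigr => b _ do rewrite degree_add_isolated_new subn0.
  by rewrite sum_nat_const card_ord.
have [G G_reg distG] := complete_to_regular deg_le k_lt_full sum_def.
exists G; split=> //; rewrite -(energy_add_isolated R s H).
have skn_gt0 : (0 < s * k * (t + s))%N by rewrite !muln_gt0; lia.
rewrite -(@ltr_pXn2r _ 2) ?nnegrE ?mulr_ge0 ?sqrtr_ge0 ?ler0n //.
apply: le_lt_trans (energy_dist _ _ _) _.
rewrite exprMn sqr_sqrtr ?ler0n // -natrX -natrM ltr_nat.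
apply: leq_ltn_trans (leq_mul (leqnn _) distG) _.
have := even_halfK sk_even; lia.
Qed.
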